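(* Let $h$ be a probability density function on $[0,1]$ that is twice continuously differentiable, non-negative and concave, with bounded second derivative. Then for every $\epsilon\in(0,1)$, $$\inf_{s\in\mathcal{S}}K(h\|s)\le\epsilon;$$ equivalently, for every $\epsilon\in(0,1)$ there exists a density $s\in\mathcal{S}$ with $K(h\|s)\le\epsilon$.
   Context: Write $[m]=\{1,\dots,m\}$. For $\theta\in(0,1)$ the triangular density on $[0,1]$ is $f(x;\theta)=2x/\theta$ if $x<\theta$ and $f(x;\theta)=2(1-x)/(1-\theta)$ if $x\ge\theta$; moreover $f(x;0)=2(1-x)$ and $f(x;1)=2x$. For $m\in\mathbb{N}$ let $$\tilde\Theta_m=\{\boldsymbol{\theta}^\top=(\pi_1,\dots,\pi_m,\theta_1,\dots,\theta_m):\pi_i\ge0,\ \theta_i\in[0,1],\ i\in[m]\}$$ (weights need not sum to one), and for $\boldsymbol{\theta}\in\tilde\Theta_m$ put $f(x;\boldsymbol{\theta})=\sum_{i=1}^m\pi_i f(x;\theta_i)$, $x\in[0,1]$. The class of squared polygonal densities is $$\mathcal{S}=\Big\{s(x)=f^2(x;\boldsymbol{\theta}):\ \boldsymbol{\theta}\in\tilde\Theta_{g+1},\ \|f(\cdot;\boldsymbol{\theta})\|_2^2=1,\ g\in\mathbb{N}\Big\},\qquad \|u\|_2=\Big(\int_0^1u^2(x)\,dx\Big)^{1/2}.$$ For densities $h,s$ on $[0,1]$, the Kullback–Leibler divergence is $K(h\|s)=\int_0^1h(x)\log\frac{h(x)}{s(x)}\,dx$. *)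

(* Defs.v *)
From HB Require Import structures.
From mathcomp Require Import all_boot all_order all_algebra.
From mathcomp Require Import all_classical all_reals all_analysis.

Set Implicit Arguments.
Unset Strict Implicit.
Unset Printing Implicit Defensive.

Import Order.TTheory GRing.Theory Num.Theory.
Import numFieldNormedType.Exports.

Local Open Scope classical_set_scope.
Local Open Scope ring_scope.

(* Functions on [0, 1] are represented by functions R -> R of which only the
   restriction to `[0, 1] is ever used. *)

Definition density01 (R : realType) (h : R -> R) : Prop :=
  [/\ forall x : R, x \in `[0, 1] -> 0 <= h x,
      measurable_fun (`[0, 1]%classic : set R) h &
      (\int[lebesgue_measure]_(x in `[0%R, 1%R]) (h x)%:E)%E = 1%E].

Definition concave_function (R : realType) (D : set R) (h : R -> R) : Prop :=
  @convex_function R R^o D (fun x => - h x).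

(* Derivative relative to D: at an endpoint of an interval D this is the
   one-sided derivative. *)
Definition is_derivative_on (R : realType) (D : set R) (h h' : R -> R) : Prop :=
  forall x : R, D x -> (h y - h x) / (y - x) @[y --> within D x^'] --> h' x.

Definition triangular (R : realType) (theta x : R) : R :=
  if theta == 0 then 2 * (1 - x)
  else if theta == 1 then 2 * x
  else if x < theta then 2 * x / theta
  else 2 * (1 - x) / (1 - theta).

Definition polygonal (R : realType) (m : nat) (p theta : 'I_m -> R) (x : R) : R :=
  \sum_(i < m) p i * triangular (theta i) x.

Definition param_space (R : realType) (m : nat) (p theta : 'I_m -> R) : Prop :=
  forall i, 0 <= p i /\ theta i \in `[0, 1].

Definition l2norm01 (R : realType) (u : R -> R) : R :=
  Num.sqrt (\int[lebesgue_measure]_(x in `[0, 1]) (u x ^+ 2)).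

Definition squared_polygonal (R : realType) : set (R -> R) :=
  [set s | exists (g : nat) (p theta : 'I_g.+1 -> R),
    [/\ param_space p theta,
        l2norm01 (polygonal p theta) ^+ 2 = 1 &
        forall x : R, x \in `[0, 1] -> s x = polygonal p theta x ^+ 2]].

(* The product, quotient and logarithm are those of the extended reals, which
   give the usual conventions: the integrand is 0 where h vanishes, and +oo
   where s vanishes and h > 0. *)
Definition KL (R : realType) (h s : R -> R) : \bar R :=
  (\int[lebesgue_measure]_(x in `[0%R, 1%R])
     ((h x)%:E * lne ((h x)%:E / (s x)%:E)))%E.

(* Main.v *)
(* The nonnegative combinations of triangular densities are exactly the concave
   nonnegative polygonal functions, so they contain the piecewise linear
   interpolants of the concave function [sqrt h], as well as the constants.
   Approximating [sqrt h] from above avoids any difficulty where [h] vanishes: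
   if [sqrt h <= f <= sqrt h + d] and [c] is the integral of [f^2], then
   [s = f^2 / c] satisfies [h <= c s], whence [K(h || s) <= log c <= c - 1], and
   [c - 1] is of order [d]. *)

Require Import Defs.
From HB Require Import structures.
From mathcomp Require Import all_boot all_order all_algebra.
From mathcomp Require Import all_classical all_reals all_analysis.
From mathcomp Require Import measurable_realfun ring lra.

Set Implicit Arguments.
Unset Strict Implicit.
Unset Printing Implicit Defensive.

Import Order.TTheory GRing.Theory Num.Theory.
Import numFieldNormedType.Exports.

Local Open Scope classical_set_scope.
Local Open Scope ring_scope.

(** * Triangular densities and piecewise linear interpolation on a uniform grid *)

Lemma hat_triangular (R : realType) (t x : R) : 0 < t < 1 ->
  t * (1 - t) / 2 * triangular t x = x * (1 - t) - Num.max 0 (x - t).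
Proof.
move=> /andP[t0 t1]; rewrite /triangular gt_eqF// lt_eqF//.
have t1' : 1 - t != 0 by rewrite subr_eq0 gt_eqF.
have t0' : t != 0 by rewrite gt_eqF.
case: ltP => xt.
- by rewrite max_l ?subr_le0 ?ltW//; field.
- by rewrite max_r ?subr_ge0//; field.
Qed.

Lemma triangular0 (R : realType) (x : R) : triangular 0 x = 2 * (1 - x).
Proof. by rewrite /triangular eqxx. Qed.

Lemma triangular1 (R : realType) (x : R) : triangular 1 x = 2 * x.
Proof. by rewrite /triangular oner_eq0 eqxx. Qed.

Lemma measurable_triangular (R : realType) (D : set R) (t : R) :
  measurable D -> measurable_fun D (triangular t).
Proof.
move=> mD; rewrite /triangular.
have m1x : measurable_fun D (fun x : R => 2 * (1 - x)).
  by apply: measurable_funM => //; exact: measurable_funB.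
case: eqP => // _; case: eqP => _; first exact: measurable_funM.
apply: measurable_funTS; apply: measurable_fun_ifT.
- by apply: measurable_fun_ltr.
- by apply: measurable_funM => //; exact: measurable_funM.
- by apply: measurable_funM => //; apply: measurable_funM => //; exact: measurable_funB.
Qed.

Lemma measurable_polygonal (R : realType) (D : set R) m (p t : 'I_m -> R) :
  measurable D -> measurable_fun D (polygonal p t).
Proof.
move=> mD; apply: measurable_sum => i.
by apply: measurable_funM => //; exact: measurable_triangular.
Qed.

(* The slopes telescope: after its first [k] hinges, the sum of hinge functions
   continues as the chord of [u] over the [k]-th cell of the grid of step [1/n]. *)
Lemma second_difference_sum (R : realType) (n : R) (u : nat -> R) k x : n != 0 ->
  u 0%N + n * (u 1%N - u 0%N) * x
    - \sum_(i < k) n * (2 * u i.+1 - u i - u i.+2) * (x - i.+1%:R / n)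
  = u k + n * (u k.+1 - u k) * (x - k%:R / n).
Proof.
move=> n0; elim: k => [|k IH]; first by rewrite big_ord0 mul0r; ring.
rewrite big_ord_recr/= opprD addrA IH -[k.+1%:R]natr1.
by field.
Qed.

Lemma cell_exists (R : realType) N (x : R) : 0 <= x <= 1 ->
  exists2 k, (k <= N)%N & k%:R / N.+1%:R <= x <= k.+1%:R / N.+1%:R.
Proof.
move=> /andP[x0 x1]; have n0 : 0 < N.+1%:R :> R by rewrite ltr0n.
have y0 : 0 <= x * N.+1%:R by rewrite mulr_ge0// ltW.
have /andP[k1 k2] := truncn_itv y0.
have [kN|Nk] := leqP (Num.trunc (x * N.+1%:R)) N.
  exists (Num.trunc (x * N.+1%:R)) => //.
  by rewrite ler_pdivrMr// ler_pdivlMr// k1 ltW.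
(* Here [x = 1], whose truncation overshoots to [N.+1]; it is the right end of the last cell. *)
exists N => //; rewrite ler_pdivrMr// divff ?gt_eqF// x1 andbT.
by rewrite (le_trans _ k1)// ler_nat ltnW.
Qed.

(* The weights at the two endpoints are halved because [triangular 0] and
   [triangular 1] have maximum 2, as all triangular densities do. *)
Definition interp_weight (R : realType) (N : nat) (u : nat -> R) (i : nat) : R :=
  if i == 0%N then u 0%N / 2 else
  if i == N.+1 then u N.+1 / 2 else
  let t := i%:R / N.+1%:R in
  N.+1%:R * (2 * u i - u i.-1 - u i.+1) * (t * (1 - t) / 2).

Lemma grid_itv (R : realType) N i : (i <= N.+1)%N ->
  (i%:R / N.+1%:R : R) \in `[0, 1].
Proof.
by move=> iN; rewrite in_itv/= divr_ge0// ler_pdivrMr ?ltr0n// mul1r ler_nat.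
Qed.

Lemma interior_grid_itv (R : realType) N (i : nat) : (i < N)%N ->
  0 < (i.+1%:R / N.+1%:R : R) < 1.
Proof.
move=> iN; rewrite divr_gt0 ?ltr0n//=.
by rewrite ltr_pdivrMr ?ltr0n// mul1r ltr_nat.
Qed.

Definition interp (R : realType) N (u : nat -> R) : R -> R :=
  @polygonal R N.+2 (fun i => interp_weight N u i) (fun i => i%:R / N.+1%:R).

(** A discrete Green representation: with [t] the node, [x * (1 - t) - Num.max 0 (x - t)] is the
    Green function of minus the second derivative with zero boundary values. It is weighted by
    negated second differences and added to the chord between the endpoint values. *)
Lemma interpE (R : realType) N (u : nat -> R) x :
  interp N u x = u 0%N * (1 - x) + u N.+1 * x
  + \sum_(i < N) N.+1%:R * (2 * u i.+1 - u i - u i.+2)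
      * (x * (1 - i.+1%:R / N.+1%:R) - Num.max 0 (x - i.+1%:R / N.+1%:R)).
Proof.
rewrite /interp /polygonal big_ord_recl big_ord_recr/=.
rewrite /interp_weight eqxx mul0r triangular0 /bump leq0n add1n eqxx.
rewrite divff ?pnatr_eq0// triangular1 /= [X in _ + X]addrC addrA.
congr (_ + _); first by field.
apply: eq_bigr => -[i iN] _ /=; rewrite add1n eqSS ltn_eqF//.
rewrite -mulrA; congr (_ * _).
by rewrite hat_triangular// interior_grid_itv.
Qed.

Lemma interp_cellE (R : realType) N (u : nat -> R) k x : (k <= N)%N ->
  k%:R / N.+1%:R <= x <= k.+1%:R / N.+1%:R ->
  interp N u x = u k + N.+1%:R * (u k.+1 - u k) * (x - k%:R / N.+1%:R).
Proof.
move=> kN /andP[kx xk]; rewrite interpE.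
have n0 : N.+1%:R != 0 :> R by rewrite pnatr_eq0.
pose d i := N.+1%:R * (2 * u i.+1 - u i - u i.+2).
(* A hinge vanishes to the left of its node, so on cell [k] only the first [k] contribute. *)
have hinges : \sum_(i < N) d i * Num.max 0 (x - i.+1%:R / N.+1%:R) =
              \sum_(i < k) d i * (x - i.+1%:R / N.+1%:R).
  rewrite (big_ord_widen _ (fun i => d i * (x - i.+1%:R / N.+1%:R)) kN).
  rewrite [RHS]big_mkcond/=; apply: eq_bigr => i _; case: ltnP => ik.
  - by rewrite max_r// subr_ge0 (le_trans _ kx)// ler_pM2r ?ler_nat//.
  - by rewrite max_l ?mulr0// subr_le0 (le_trans xk)// ler_pM2r ?ler_nat//.
(* The initial slope is that of the first chord: evaluate the telescoped identity at [x = 1] with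
   [k = N], where the last chord reaches [u N.+1]. *)
have slope0 : u N.+1 - u 0%N + \sum_(i < N) d i * (1 - i.+1%:R / N.+1%:R) =
              N.+1%:R * (u 1%N - u 0%N).
  have := second_difference_sum u N 1 n0.
  have -> : N.+1%:R * (u N.+1 - u N) * (1 - N%:R / N.+1%:R) = u N.+1 - u N.
    rewrite -natr1; field.
    by rewrite natr1.
  rewrite -/(d _); move: (\sum_(i < N) _) => S; lra.
rewrite -second_difference_sum// -hinges -slope0.
under eq_bigr do rewrite mulrBr.
rewrite sumrB.
under eq_bigr do rewrite [x * _]mulrC mulrA.
by rewrite -mulr_suml; ring.
Qed.

(** * Uniform approximation of continuous concave functions from above *)

Lemma heine_cantor (R : realType) (K : set R) (f : R -> R) : compact K ->
  {within K, continuous f} -> forall e : R, 0 < e ->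
  exists2 d : R, 0 < d &
    forall x y, K x -> K y -> `|x - y| < d -> `|f x - f y| < e.
Proof.
move=> cK /subspace_continuousP cf e e0.
have e20 : 0 < e / 2 by rewrite divr_gt0.
pose P d x := forall y, K y -> `|x - y| < d -> `|f x - f y| < e.
suff : \forall d \near 0^'+, K `<=` P d.
  move=> H; near (0 : R)^'+ => d.
  exists d; first by near: d; exact: nbhs_right_gt.
  by move=> x y Kx Ky xyd; have := near H d; exact.
(* By compactness, it suffices to treat all [z] near a fixed [x] together with all small [d]. *)
move/compact_near_coveringP/near_covering_withinP : cK; apply => x Kx.
have /cvgrPdist_lt/(_ _ e20) := cf x Kx.
rewrite near_withinE => /nbhs_ballP[r /= r0 xr].
have r20 : 0 < r / 2 by rewrite divr_gt0.
(* With [z] within [r / 2] of [x] and [d < r / 2], both [z] and [y] lie within [r] of [x], each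
   costing [e / 2]. *)
near=> z d => Kz y Ky zy.
have xz : `|x - z| < r / 2 by near: z; exact: nbhsx_ballx.
have dr : d < r / 2 by near: d; exact: nbhs_right_lt.
have -> : f z - f y = (f x - f y) - (f x - f z) by ring.
rewrite (le_lt_trans (ler_normB _ _))// (splitr e) ltrD//.
- apply: xr => //; rewrite /ball/=.
  have -> : x - y = (x - z) + (z - y) by ring.
  rewrite (le_lt_trans (ler_normD _ _))// (splitr r) ltrD//.
  exact: lt_trans dr.
- by apply: xr => //; rewrite /ball/= (lt_le_trans xz)//; lra.
Unshelve. all: by end_near. Qed.

(** On a cell the interpolant is a convex combination of two node values, and both nodes lie within
    one grid step of [x]. *)
Lemma interp_approx (R : realType) N (g : R -> R) (e x : R) :
  {in `[0, 1] &, forall y z, `|y - z| <= N.+1%:R^-1 -> `|g y - g z| <= e} ->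
  x \in `[0, 1] ->
  `|g x - interp N (fun i => g (i%:R / N.+1%:R)) x| <= e.
Proof.
move=> ge /[dup] xI; rewrite in_itv/= => /[dup] x01 /cell_exists-/(_ N)[k kN kx].
rewrite (interp_cellE _ kN kx)/=.
have n0 : 0 < N.+1%:R :> R by rewrite ltr0n.
have step : k.+1%:R / N.+1%:R = k%:R / N.+1%:R + N.+1%:R^-1 :> R.
  by rewrite -natr1 mulrDl mul1r.
set l := N.+1%:R * (x - k%:R / N.+1%:R).
have l0 : 0 <= l by case/andP: kx => kx _; rewrite mulr_ge0 ?subr_ge0.
have l1 : l <= 1.
  by rewrite /l mulrC -ler_pdivlMr// mul1r lerBlDl -step; case/andP: kx.
rewrite step in kx; case/andP: kx => kx xk.
have Ha : `|g x - g (k%:R / N.+1%:R)| <= e.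
  apply: ge => //; first exact/grid_itv/leqW.
  by rewrite ger0_norm ?subr_ge0// lerBlDl.
have Hb : `|g x - g (k.+1%:R / N.+1%:R)| <= e.
  apply: ge => //; first exact: grid_itv.
  by rewrite distrC ger0_norm step ?subr_ge0// lerBlDr addrC lerD2l.
set a := g (k%:R / _) in Ha *; set b := g (k.+1%:R / _) in Hb *.
have -> : g x - (a + N.+1%:R * (b - a) * (x - k%:R / N.+1%:R)) =
          (1 - l) * (g x - a) + l * (g x - b) by rewrite /l; ring.
clearbody l.
rewrite (le_trans (ler_normD _ _))// !normrM (ger0_norm l0) ger0_norm ?subr_ge0//.
have : (1 - l) * `|g x - a| <= (1 - l) * e by rewrite ler_wpM2l// subr_ge0.
have : l * `|g x - b| <= l * e by rewrite ler_wpM2l.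
lra.
Qed.

(** An interior weight is a positive multiple of a negated second difference, whose sign is midpoint
    concavity applied to the two neighbouring nodes. *)
Lemma interp_weight_ge0 (R : realType) N (g : R -> R) i :
  {in `[0, 1], forall x, 0 <= g x} ->
  {in `[0, 1] &, forall x y, g x + g y <= 2 * g ((x + y) / 2)} ->
  (i <= N.+1)%N ->
  0 <= interp_weight N (fun i => g (i%:R / N.+1%:R)) i.
Proof.
move=> g0 gc iN; rewrite /interp_weight.
case: eqP => [_|/eqP]; first by rewrite divr_ge0// g0// grid_itv.
case: i iN => // i; rewrite ltnS leq_eqVlt => /predU1P[->|iN] _.
  by rewrite eqxx divr_ge0// g0// grid_itv.
rewrite eqSS ltn_eqF//=.
have /andP[t0 t1] := interior_grid_itv R iN.
rewrite mulr_ge0//; last by rewrite divr_ge0// mulr_ge0 ?subr_ge0// ltW.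
rewrite mulr_ge0//.
have := gc _ _ (grid_itv R (leqW (ltnW iN))) (grid_itv R (iN : i.+2 <= N.+1)%N).
have -> : (i%:R / N.+1%:R + i.+2%:R / N.+1%:R) / 2 = i.+1%:R / N.+1%:R :> R.
  by rewrite -!natr1; field; rewrite natr1.
by lra.
Qed.

Lemma polygonal_sandwich (R : realType) (g : R -> R) (e : R) :
  {within `[0, 1], continuous g} ->
  {in `[0, 1], forall x, 0 <= g x} ->
  {in `[0, 1] &, forall x y, g x + g y <= 2 * g ((x + y) / 2)} ->
  0 < e ->
  exists (m : nat) (p t : 'I_m.+1 -> R), param_space p t /\
    {in `[0, 1], forall x, g x <= polygonal p t x <= g x + e}.
Proof.
move=> gcont g0 gconc e0.
have e20 : 0 < e / 2 by rewrite divr_gt0.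
have [d d0 gd] := heine_cantor (@segment_compact _ 0 1) gcont e20.
pose N := Num.trunc d^-1.
have Nd : N.+1%:R^-1 < d.
  by rewrite invf_plt ?posrE ?ltr0n// truncnS_gt.
(* Raising [g] by [e / 2] turns a two-sided error [e / 2] into a bound from above, and preserves
   nonnegativity and concavity. *)
pose u i := g (i%:R / N.+1%:R) + e / 2.
exists N.+1, (fun i => interp_weight N u i), (fun i => i%:R / N.+1%:R); split.
- move=> i; split.
    apply: (@interp_weight_ge0 _ N (fun x => g x + e / 2)).
    + by move=> x /g0 gx; rewrite addr_ge0// ltW.
    + by move=> x y xI yI; have := gconc _ _ xI yI; lra.
    + exact: leq_ord.
  by rewrite grid_itv ?leq_ord.
- move=> x xI.
  have := @interp_approx _ N (fun x => g x + e / 2) (e / 2) x _ xI.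
  rewrite -/(interp N u).
  have H : {in `[0, 1] &, forall y z, `|y - z| <= N.+1%:R^-1 ->
     `|g y + e / 2 - (g z + e / 2)| <= e / 2}.
    move=> y z yI zI yz; have -> : g y + e / 2 - (g z + e / 2) = g y - g z by ring.
    by rewrite ltW// gd// (le_lt_trans yz).
  move=> /(_ H); rewrite -/u ler_norml; lra.
Qed.

(** * Continuity and concavity of the square root of [h] *)

Lemma is_derivative_on_continuous (R : realType) (D : set R) (h h1 : R -> R) :
  is_derivative_on D h h1 -> {within D, continuous h}.
Proof.
move=> dh; apply/subspace_continuousP => x Dx.
apply/cvgrPdist_lt => e e0.
(* Tolerance 1 in the derivative limit bounds the difference quotient near [x] by [|h1 x| + 1]. *)
have /cvgrPdist_lt/(_ _ ltr01) := dh x Dx.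
rewrite !near_withinE => /nbhs_ballP[r /= r0 xr].
have M0 : 0 < `|h1 x| + 1 by rewrite ltr_wpDl.
have eM0 : 0 < e / (`|h1 x| + 1) by rewrite divr_gt0.
near=> y => Dy; have [->|yx] := eqVneq y x; first by rewrite subrr normr0.
have yx0 : y - x != 0 by rewrite subr_eq0.
have := xr y; set q := _ / _ => /(_ _ yx Dy) xq.
have {}xq : `|h1 x - q| < 1 by apply: xq; near: y; exact: nbhsx_ballx.
have q1 : `|q| <= `|h1 x| + 1.
  have -> : q = h1 x - (h1 x - q) by ring.
  by rewrite (le_trans (ler_normB _ _))// lerD2l ltW.
have -> : h x - h y = q * (x - y) by rewrite -[RHS]opprK -mulrN opprB divfK ?opprB.
rewrite normrM (le_lt_trans (ler_wpM2r _ q1))// mulrC -ltr_pdivlMr//.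
Unshelve. all: by end_near. Qed.

(** Compare squares: with [a], [b] the two roots, [(a + b)^2 <= 2 * (a^2 + b^2) <= 4 * h ((x + y) /
    2)], by [(a - b)^2 >= 0] and then concavity of [h]. *)
Lemma sqrt_midpoint_concave (R : realType) (h : R -> R) :
  {in `[0, 1], forall x, 0 <= h x} -> concave_function `[0, 1] h ->
  {in `[0, 1] &, forall x y : R,
    Num.sqrt (h x) + Num.sqrt (h y) <= 2 * Num.sqrt (h ((x + y) / 2))}.
Proof.
move=> h0 hc x y xI yI.
have half01 : 0 <= (2^-1 : R) <= 1 by lra.
have mI : (x + y) / 2 \in `[0, 1].
  by move: xI yI; rewrite !in_itv/=; lra.
have hmid : (h x + h y) / 2 <= h ((x + y) / 2).
  have xI' : x \in (`[0, 1]%classic : set R) by rewrite inE.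
  have yI' : y \in (`[0, 1]%classic : set R) by rewrite inE.
  have := hc (Itv01 (proj1 (andP half01)) (proj2 (andP half01))) x y xI' yI'.
  rewrite convRE /conv/= /GRing.scale/= /unstable.onem.
  have -> : 2^-1 * x + (1 - 2^-1) * y = (x + y) / 2 :> R by field.
  by lra.
have sx := sqr_sqrtr (h0 _ xI); have sy := sqr_sqrtr (h0 _ yI).
have sm := sqr_sqrtr (h0 _ mI).
rewrite -ler_sqr ?nnegrE ?addr_ge0 ?mulr_ge0//.
have := sqr_ge0 (Num.sqrt (h x) - Num.sqrt (h y)).
rewrite sqrrB sqrrD exprMn sx sy sm; lra.
Qed.

(** * Divergence under domination, and normalization *)

Lemma KL_le_of_dominated (R : realType) (h s : R -> R) (c : R) :
  density01 h -> measurable_fun (`[0, 1]%classic : set R) s ->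
  1 <= c -> {in `[0, 1], forall x, h x <= c * s x} ->
  (KL h s <= (c - 1)%:E)%E.
Proof.
move=> [h0 mh h1] ms c1 hcs.
have cs (x : R) : x \in `[0, 1] -> h x != 0 -> 0 < h x /\ 0 < s x.
  move=> xI hx; have hx0 : 0 < h x by rewrite lt_neqAle eq_sym hx h0.
  split => //; rewrite -(pmulr_rgt0 _ (lt_le_trans ltr01 c1)).
  exact: lt_le_trans (hcs _ xI).
(* A real-valued form of the integrand: both vanish where [h] does, and elsewhere domination forces
   [s > 0]. *)
pose F x := h x * (ln (h x) - ln (s x)).
have -> : KL h s = (\int[lebesgue_measure]_(x in `[0%R, 1%R]) (F x)%:E)%E.
  apply: eq_integral => x; rewrite inE/= => xI; rewrite /F.
  have [->|hx] := eqVneq (h x) 0; first by rewrite mul0e mul0r.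
  have [hx0 sx0] := cs x xI hx.
  by rewrite inver gt_eqF// -EFinM lne_EFin ?divr_gt0// ln_div ?posrE.
(* Where [h > 0], [ln (h / s) <= h / s - 1 <= c - 1]; multiply by [h]. *)
have Fle (x : R) : x \in `[0, 1] -> F x <= (c - 1) * h x.
  move=> xI; rewrite /F mulrC; have [->|hx] := eqVneq (h x) 0.
    by rewrite !mulr0.
  have [hx0 sx0] := cs x xI hx.
  rewrite ler_wpM2r ?h0// -ln_div ?posrE//.
  have -> : h x / s x = 1 + (h x / s x - 1) by ring.
  rewrite (le_trans (le_ln1Dx _))//.
    by rewrite ltrBrDr addNr divr_gt0.
  by rewrite lerD2r ler_pdivrMr// hcs.
rewrite integralE.
have mF : measurable_fun (`[0, 1]%classic : set R) F.
  by apply: measurable_funM => //; apply: measurable_funB; exact: measurableT_comp.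
have -> : (c - 1)%:E = (\int[lebesgue_measure]_(x in `[0%R, 1%R]) ((c - 1) * h x)%:E)%E.
  under eq_integral do rewrite EFinM.
  by rewrite ge0_integralZl ?h1 ?mule1 ?lee_fin ?subr_ge0//; exact/measurable_EFinP.
(* Dropping the negative part leaves a nonnegative integrand, to which monotonicity of the integral
   applies. *)
apply: (@le_trans _ _ (\int[lebesgue_measure]_(x in `[0%R, 1%R]) (EFin \o F)^\+ x)%E).
  by rewrite geeDl// leeNl oppe0 integral_ge0.
apply: ge0_le_integral => //.
- by apply: measurable_funepos; exact/measurable_EFinP.
- by apply/measurable_EFinP; exact: measurable_funM.
- move=> x xI; rewrite funeposE ge_max lee_fin Fle//=.
  by rewrite lee_fin mulr_ge0 ?subr_ge0// h0.
Qed.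

(** [polygonal] is linear in its weights, so dividing them by [Num.sqrt c] divides the square by [c]
    and keeps them nonnegative. *)
Lemma normalized_squared_polygonal (R : realType) m (p t : 'I_m.+1 -> R) (c : R) :
  param_space p t -> 0 < c ->
  (\int[lebesgue_measure]_(x in `[0%R, 1%R]) (polygonal p t x ^+ 2)%:E)%E = c%:E ->
  exists s : R -> R, [/\ squared_polygonal s, density01 s &
    forall x, c * s x = polygonal p t x ^+ 2].
Proof.
move=> pt c0 intc; have c0' : c != 0 by rewrite gt_eqF.
pose q i := p i / Num.sqrt c.
have qE x : polygonal q t x ^+ 2 = c^-1 * polygonal p t x ^+ 2.
  rewrite /polygonal (eq_bigr (fun i => (Num.sqrt c)^-1 * (p i * triangular (t i) x))).
    by rewrite -mulr_sumr exprMn exprVn sqr_sqrtr// ltW.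
  by move=> i _; rewrite /q; ring.
have mq : measurable_fun (`[0, 1]%classic : set R) (fun x => polygonal q t x ^+ 2).
  by apply: measurable_funX; exact: measurable_polygonal.
have intq : (\int[lebesgue_measure]_(x in `[0%R, 1%R])
    (polygonal q t x ^+ 2)%:E)%E = 1%E.
  under eq_integral do rewrite qE EFinM.
  rewrite ge0_integralZl ?intc ?lee_fin ?invr_ge0 ?ltW//.
  - by rewrite -EFinM mulVf.
  - apply/measurable_EFinP; apply: measurable_funX.
    exact: measurable_polygonal.
  - by move=> x _; rewrite lee_fin sqr_ge0.
exists (fun x => polygonal q t x ^+ 2); split.
- exists m, q, t; split=> //.
    by move=> i; have [p0 ti] := pt i; rewrite /q divr_ge0.
  by rewrite /l2norm01 /Rintegral intq /= sqrtr1 expr1n.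
- by split => // x _; rewrite sqr_ge0.
- by move=> x; rewrite qE mulrA divff// mul1r.
Qed.

Theorem proposition2 (R : realType) (h h1 h2 : R -> R)
    (h_density : density01 h)
    (h_deriv1 : is_derivative_on `[0, 1] h h1)
    (h_deriv2 : is_derivative_on `[0, 1] h1 h2)
    (h2_continuous : {within (`[0, 1]%classic : set R), continuous h2})
    (h2_bounded : [bounded h2 x : R^o | x in (`[0, 1]%classic : set R)])
    (h_ge0 : forall x : R, x \in `[0, 1] -> 0 <= h x)
    (h_concave : concave_function `[0, 1] h)
    (eps : R) (eps_in01 : eps \in `]0, 1[) :
  (ereal_inf [set KL h s | s in @squared_polygonal R] <= eps%:E)%E /\
  exists s : R -> R,
    [/\ squared_polygonal s, density01 s & (KL h s <= eps%:E)%E].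
Proof.
suff [s [sS sD sK]] : exists s : R -> R,
    [/\ squared_polygonal s, density01 s & (KL h s <= eps%:E)%E].
  split; last by exists s.
  by apply: (le_trans _ sK); apply: ereal_inf_lbound; exists s.
have [_ mh inth] := h_density.
have {eps_in01}[e0 e1] : 0 < eps /\ eps < 1.
  by move: eps_in01; rewrite in_itv/= => /andP[].
have sqrth_cont : {within `[0, 1], continuous (fun x => Num.sqrt (h x))}.
  move/is_derivative_on_continuous/subspace_continuousP : h_deriv1 => hcont.
  apply/subspace_continuousP => x xI.
  by apply: (continuous_cvg _ (@sqrt_continuous R (h x))); exact: hcont.
(* The upper bound [(1 + d) * h + 2 * d] for [f ^+ 2] integrates to [1 + 3 * d], which is
   [1 + eps]. *)
pose d := eps / 3.
have d0 : 0 < d by rewrite divr_gt0.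
have [m [p [t [pt sandwich]]]] := polygonal_sandwich sqrth_cont
  (fun x _ => sqrtr_ge0 (h x)) (sqrt_midpoint_concave h_ge0 h_concave) d0.
pose f := polygonal p t.
have h_le x : x \in `[0, 1] -> h x <= f x ^+ 2.
  move=> xI; have /andP[gf _] := sandwich _ xI.
  by rewrite -(sqr_sqrtr (h_ge0 _ xI)) ler_sqr ?nnegrE// (le_trans _ gf).
have f_le x : x \in `[0, 1] -> f x ^+ 2 <= (1 + d) * h x + 2 * d.
  move=> xI; have /andP[gf fg] := sandwich _ xI.
  have f2 : f x ^+ 2 <= (Num.sqrt (h x) + d) ^+ 2.
    rewrite ler_sqr ?nnegrE ?addr_ge0//; last exact: ltW.
    exact: le_trans gf.
  apply: (le_trans f2); rewrite sqrrD sqr_sqrtr ?h_ge0//.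
  (* AM-GM: [2 * sqrt h <= h + 1] *)
  have : 0 <= d * (Num.sqrt (h x) - 1) ^+ 2 by rewrite mulr_ge0 ?sqr_ge0// ltW.
  (* Since [d < 1], the term [d ^+ 2] is absorbed into a second [d]. *)
  have : 0 <= d * (1 - d) by rewrite mulr_ge0 ?ltW// /d; lra.
  rewrite sqrrB sqr_sqrtr ?h_ge0//; lra.
have mf2 : measurable_fun (`[0, 1]%classic : set R) (fun x => f x ^+ 2).
  by apply: measurable_funX; exact: measurable_polygonal.
pose I := (\int[lebesgue_measure]_(x in `[0%R, 1%R]) (f x ^+ 2)%:E)%E.
have I_ge1 : (1 <= I)%E.
  rewrite -inth; apply: ge0_le_integral => [//|x xI||| x xI].
  - by rewrite lee_fin h_ge0.
  - exact/measurable_EFinP.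
  - exact/measurable_EFinP.
  - by rewrite lee_fin h_le.
have I_le : (I <= (1 + eps)%:E)%E.
  have mdh : measurable_fun (`[0, 1]%classic : set R) (fun x => (1 + d) * h x).
    exact: measurable_funM.
  apply: (@le_trans _ _ (\int[lebesgue_measure]_(x in `[0%R, 1%R])
      ((1 + d) * h x + 2 * d)%:E)%E).
    apply: ge0_le_integral => [//|x _||| x xI].
    - by rewrite lee_fin sqr_ge0.
    - exact/measurable_EFinP.
    - by apply/measurable_EFinP; exact: measurable_funD.
    - by rewrite lee_fin f_le.
  under eq_integral do rewrite EFinD.
  rewrite ge0_integralD//.
  - under eq_integral do rewrite EFinM.
    rewrite ge0_integralZl ?inth//; last 2 first.
    + exact/measurable_EFinP.
    + by rewrite lee_fin; lra.
    rewrite integral_cst//= lebesgue_measure_itv/= lte_fin ltr01 oppr0 adde0.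
    by rewrite !mule1 -EFinD lee_fin /d; lra.
  - by move=> x xI; rewrite lee_fin mulr_ge0 ?h_ge0//; lra.
  - exact/measurable_EFinP.
  - by move=> x _; rewrite lee_fin; lra.
(* The two bounds make [I] finite, so its real value [c] lies between [1] and [1 + eps]. *)
have cE : I = (fine I)%:E.
  by rewrite fineK// fin_numElt (lt_le_trans _ I_ge1) ?ltNyr// (le_lt_trans I_le) ?ltry.
set c := fine I in cE.
have c1 : 1 <= c by rewrite -lee_fin -cE.
have [s [sS sD sE]] := normalized_squared_polygonal pt (lt_le_trans ltr01 c1) cE.
exists s; split => //; have [_ ms _] := sD.
have hcs : {in `[0, 1], forall x, h x <= c * s x} by move=> x xI; rewrite sE h_le.
apply: (le_trans (KL_le_of_dominated h_density ms c1 hcs)).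
by rewrite lee_fin lerBlDl -lee_fin -cE.
Qed.
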